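(* Let $|\phi\rangle_{ABCD}$ be a four-qubit pure state and let $i\neq j$ be two of the systems $A,B,C,D$. If $F_{ij}^{(4)}\left(|\phi\rangle_{ABCD}\right)=\frac23$, then $|\phi\rangle_{ABCD}\in SEP(G_i:G_j)$ for some bipartition $\{G_i|G_j\}$ of $\{A,B,C,D\}$ with $i\in G_i$ and $j\in G_j$.
   Context: States of four qubits $A,B,C,D$ are density operators on $(\mathbb{C}^2)^{\otimes 4}$; pure states are unit vectors. $|\psi\rangle_{S_1S_2}\in SEP(S_1:S_2)$ means that the pure state is separable (a product vector) between $S_1$ and $S_2$. Fully entangled fraction: for a two-qubit state $\rho$, $f(\rho)=\max_{|e\rangle}\langle e|\rho|e\rangle$, the maximum being over all maximally entangled unit vectors $|e\rangle\in\mathbb{C}^2\otimes\mathbb{C}^2$ (both reduced states equal to $I/2$). For distinct systems $i,j$ let $K=\{k_1,k_2\}=\{A,B,C,D\}\setminus\{i,j\}$ and define $$f_{ij}^{(4)}(\rho)=\max_{U_K}\sum_{J\in\{0,1\}^{2}}\langle J|U_K\rho_KU_K^\dagger|J\rangle\, f\!\left(\rho_{ij}^{U_K,J}\right),\qquad F_{ij}^{(4)}(\rho)=\frac{2f_{ij}^{(4)}(\rho)+1}{3},$$ where $U_K=U_{k_1}\otimes U_{k_2}$ ranges over products of one-qubit unitaries, $\rho_K$ is the reduced state of $\rho$ on $K$, and $\rho_{ij}^{U_K,J}$ is the normalized state of $i,j$ after each $k_l$ is measured in the basis $\{U_{k_l}^\dagger|0\rangle,U_{k_l}^\dagger|1\rangle\}$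 with joint outcome $J$ (zero-probability terms count as $0$). *)

(* Defs.v *)
From HB Require Import structures.
From mathcomp Require Export all_boot all_order all_algebra.
From mathcomp Require Export complex spectral.
From mathcomp Require Export boolp classical_sets reals.

Set Implicit Arguments.
Unset Strict Implicit.
Unset Printing Implicit Defensive.

Import Order.TTheory GRing.Theory Num.Theory.
Local Open Scope ring_scope.
Local Open Scope sesquilinear_scope.
Local Open Scope complex_scope.

(* R : realType is the field of real numbers and R[i] that of complex numbers.
   The Hilbert space with orthonormal basis indexed by a finite type T is
   C^#|T|, the basis vector of index t : T being the coordinate enum_rank t. *)
Notation ket R T := 'cV[R[i]]_#|{: T}|.
Notation linop R T1 T2 := 'M[R[i]]_(#|{: T1}|, #|{: T2}|).
Notation op R T := (linop R T T).

Definition entry (R : realType) (T1 T2 : finType) (A : linop R T1 T2)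
  (x : T1) (y : T2) : R[i] := A (enum_rank x) (enum_rank y).

Definition mxof (R : realType) (T1 T2 : finType) (a : T1 -> T2 -> R[i]) :
  linop R T1 T2 := \matrix_(x, y) a (enum_val x) (enum_val y).

Definition pure_state (R : realType) (T : finType) (v : ket R T) : Prop :=
  v^t* *m v = 1%:M.

Definition proj (R : realType) (T : finType) (v : ket R T) : op R T :=
  v *m v^t*.

(* Real part of <v|rho|v>, which is the value itself when rho is Hermitian. *)
Definition expectation (R : realType) (T : finType) (v : ket R T)
  (rho : op R T) : R := complex.Re ((v^t* *m rho *m v) 0 0).

Definition reduced1 (R : realType) (T1 T2 : finType)
  (rho : op R (T1 * T2)%type) : op R T1 :=
  mxof (fun a a' => \sum_(b : T2) entry rho (a, b) (a', b)).

Definition reduced2 (R : realType) (T1 T2 : finType)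
  (rho : op R (T1 * T2)%type) : op R T2 :=
  mxof (fun b b' => \sum_(a : T1) entry rho (a, b) (a, b')).

Definition two_qubits : finType := ('I_2 * 'I_2)%type.

Definition max_entangled (R : realType) (e : ket R two_qubits) : Prop :=
  [/\ pure_state e,
      reduced1 (proj e : op R ('I_2 * 'I_2)%type) = (2^-1)%:M &
      reduced2 (proj e : op R ('I_2 * 'I_2)%type) = (2^-1)%:M].

(* The maximally entangled unit vectors form a nonempty compact set, so this
   supremum is a maximum. *)
Definition fully_entangled_fraction (R : realType) (rho : op R two_qubits) : R :=
  sup [set expectation e rho | e in [set e | max_entangled e]]%classic.

(* Computational basis labels for qubits held by the systems in S. *)
Definition labels (P : finType) (S : {set P}) : finType :=
  {ffun {k : P | k \in S} -> 'I_2}.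

Definition all_labels (P : finType) : finType := {ffun P -> 'I_2}.

Definition restrict (P : finType) (S : {set P}) (x : all_labels P) :
  labels S := [ffun k => x (val k)].

(* Partial trace over the systems outside S: x and y below range over the
   pairs of global labels that extend a and b and agree outside S. *)
Definition reduced_state (R : realType) (P : finType) (S : {set P})
  (rho : op R (all_labels P)) : op R (labels S) :=
  mxof (fun a b => \sum_(x : all_labels P | restrict S x == a)
    \sum_(y : all_labels P | (restrict S y == b) &&
                             (restrict (~: S) y == restrict (~: S) x))
      entry rho x y).

(* |v> = |u> (x) |w> with u a pure state of S1 and w a pure state of S2; meant
   for complementary S1 and S2. *)
Definition SEP (R : realType) (P : finType) (S1 S2 : {set P})
  (v : ket R (all_labels P)) : Prop :=
  exists (u : ket R (labels S1)) (w : ket R (labels S2)),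
    [/\ pure_state u, pure_state w &
        forall x : all_labels P,
          v (enum_rank x) 0 = u (enum_rank (restrict S1 x)) 0 *
                              w (enum_rank (restrict S2 x)) 0].

Definition others (P : finType) (i j : P) : {set P} := ~: [set i; j]%SET.

Definition local_unitaries (R : realType) (P : finType) (S : {set P})
  (U : {k : P | k \in S} -> 'M[R[i]]_2) : Prop :=
  forall k, U k \is unitarymx.

Definition tensor_op (R : realType) (P : finType) (S : {set P})
  (U : {k : P | k \in S} -> 'M[R[i]]_2) : op R (labels S) :=
  mxof (fun x y : labels S => \prod_k U k (x k) (y k)).

(* <J| U_K rho_K U_K^* |J> *)
Definition outcome_prob (R : realType) (P : finType) (i j : P)
  (U : {k : P | k \in others i j} -> 'M[R[i]]_2) (J : labels (others i j))
  (rho : op R (all_labels P)) : R :=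
  complex.Re (entry (tensor_op U *m reduced_state (others i j) rho
                     *m (tensor_op U)^t*) J J).

(* The operator I_ij (x) <J|U_K from the whole system to the systems i, j (in
   this order). *)
Definition outcome_op (R : realType) (P : finType) (i j : P)
  (U : {k : P | k \in others i j} -> 'M[R[i]]_2) (J : labels (others i j)) :
  linop R two_qubits (all_labels P) :=
  mxof (fun (c : two_qubits) (x : all_labels P) =>
    ((c.1 == x i) && (c.2 == x j))%:R
      * entry (tensor_op U) J (restrict (others i j) x)).

(* Equal to 0 when the outcome J has probability 0, since 0^-1 = 0. *)
Definition post_measurement (R : realType) (P : finType) (i j : P)
  (U : {k : P | k \in others i j} -> 'M[R[i]]_2) (J : labels (others i j))
  (rho : op R (all_labels P)) : op R two_qubits :=
  ((outcome_prob U J rho)^-1)%:C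
    *: (outcome_op U J *m rho *m (outcome_op U J)^t*).

(* Each summand equals the fully entangled fraction of the unnormalized
   post-measurement operator when rho is a state, hence is continuous in U; the
   local unitaries form a compact set, so the supremum is a maximum. *)
Definition f_frac (R : realType) (P : finType) (i j : P)
  (rho : op R (all_labels P)) : R :=
  sup [set \sum_(J : labels (others i j))
             outcome_prob U J rho
               * fully_entangled_fraction (post_measurement U J rho)
      | U in [set U | @local_unitaries R P (others i j) U]]%classic.

Definition F_fid (R : realType) (P : finType) (i j : P)
  (rho : op R (all_labels P)) : R := (2 * f_frac i j rho + 1) / 3.

(* Main.v *)
Require Import Defs.
From mathcomp Require Import ring lra.

Set Implicit Arguments.
Unset Strict Implicit.
Unset Printing Implicit Defensive.

Import Order.TTheory GRing.Theory Num.Theory.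
Local Open Scope ring_scope.
Local Open Scope sesquilinear_scope.

(* Let k, l be the two systems other than i, j, and let M_J be the 2 x 2 matrix
   of amplitudes of the unnormalized state of i, j after outcome J.  A pure
   two-qubit state with amplitude matrix M has (unnormalized) fully entangled
   fraction (|M|^2 + 2 |det M|) / 2, so each U contributes 1/2 + sum_J |det M_J|.
   Hence F = 2/3, i.e. f = 1/2, forces det M_J = 0 for all U and J: contracting
   phi with any product vector a (x) b on k, l leaves a singular matrix.  This
   determinant is a biquadratic form in (a, b); after shearing the local bases so
   that a chosen nonzero amplitude has vanishing neighbours, its nine
   coefficients leave only four cases, in which phi factors along i | jkl,
   ik | jl, il | jk or ikl | j. *)

(** * Tensors with singular slices *)

Lemma ord2_case (p : 'I_2) : p = 0 \/ p = 1.
Proof. by case: p => [[|[|]]] // ?; [left | right]; apply: val_inj. Qed.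

Lemma ord2_eq01 : ((0 : 'I_2) == 1) = false. Proof. by []. Qed.
Lemma ord2_eq10 : ((1 : 'I_2) == 0) = false. Proof. by []. Qed.
Definition ord2E := (eqxx, ord2_eq01, ord2_eq10).

Lemma sum_ord2 (V : nmodType) (f : 'I_2 -> V) : \sum_i f i = f 0 + f 1.
Proof.
by rewrite !big_ord_recl big_ord0 addr0; congr (_ + f _); apply: val_inj.
Qed.

Section Tensors.
Variable F : fieldType.
Implicit Types (T : 'I_2 -> 'I_2 -> 'I_2 -> 'I_2 -> F) (s : F).

(* In T p q r t the indices p, q are those of the systems i, j, and r, t those
   of the two measured systems. *)
Definition slice T (a0 a1 b0 b1 : F) (p q : 'I_2) : F :=
  a0 * b0 * T p q 0 0 + a0 * b1 * T p q 0 1 +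
  a1 * b0 * T p q 1 0 + a1 * b1 * T p q 1 1.

Definition singular_slices T : Prop := forall a0 a1 b0 b1,
  let M := slice T a0 a1 b0 b1 in M 0 0 * M 1 1 = M 0 1 * M 1 0.

(** The four alternatives are the bipartitions that separate the first index from the second. *)
Definition splits T : Prop :=
  [\/ exists u w, forall p q r t, T p q r t = u p * w q r t,
      exists u w, forall p q r t, T p q r t = u p r * w q t,
      exists u w, forall p q r t, T p q r t = u p t * w q r |
      exists u w, forall p q r t, T p q r t = u p r t * w q].

(** * Exchanges of indices and shears *)

Definition swap12 T : 'I_2 -> 'I_2 -> 'I_2 -> 'I_2 -> F := fun p q => T q p.

Lemma splits_swap12 T : splits (swap12 T) -> splits T.
Proof.
case=> -[u [w e]]; [apply: Or44 | apply: Or43 | apply: Or42 | apply: Or41];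
  by exists w, u => p q r t; rewrite mulrC -e.
Qed.

Lemma singular_swap12 T : singular_slices T -> singular_slices (swap12 T).
Proof.
by move=> H a0 a1 b0 b1; rewrite /= mulrC [RHS]mulrC mulrC; apply: H.
Qed.

Definition swap34 T : 'I_2 -> 'I_2 -> 'I_2 -> 'I_2 -> F := fun p q r t => T p q t r.

Lemma splits_swap34 T : splits (swap34 T) -> splits T.
Proof.
case=> -[u [w e]]; [apply: Or41 | apply: Or43 | apply: Or42 | apply: Or44].
- by exists u, (fun q r t => w q t r) => p q r t; rewrite -e.
- by exists u, w => p q r t; rewrite -e.
- by exists u, w => p q r t; rewrite -e.
- by exists (fun p r t => u p t r), w => p q r t; rewrite -e.
Qed.

Lemma singular_swap34 T : singular_slices T -> singular_slices (swap34 T).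
Proof.
move=> H a0 a1 b0 b1 /=.
have e p q : slice (swap34 T) a0 a1 b0 b1 p q = slice T b0 b1 a0 a1 p q.
  by rewrite /slice /swap34; ring.
by rewrite !e; apply: H.
Qed.

(** An elementary operation undone by [shear (- s)]; when [f 0 = 1], the choice [s = f 1] clears the
    entry at 1. *)
Definition shear s (f : 'I_2 -> F) (p : 'I_2) : F :=
  f p - (p == 1)%:R * s * f 0.

Definition shear1 s T p q r t := shear s (fun p => T p q r t) p.
Definition shear2 s T p q r t := shear s (fun q => T p q r t) q.
Definition shear3 s T p q r t := shear s (fun r => T p q r t) r.
Definition shear4 s T p q r t := shear s (fun t => T p q r t) t.

(** The inverse shear acts on whichever factor carries the first index. *)
Lemma splits_shear1 s T : splits (shear1 s T) -> splits T.
Proof.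
have e p q r t : T p q r t = shear (- s) (fun p => shear1 s T p q r t) p.
  by rewrite /shear1 /shear !ord2E /=; ring.
move: (shear1 s T) e => T' e; case=> -[u [w H]];
  [apply: Or41 | apply: Or42 | apply: Or43 | apply: Or44].
- by exists (shear (- s) u), w => p q r t;
  rewrite e /shear !H /=; ring.
- by exists (fun p r => shear (- s) (u^~ r) p), w => p q r t;
  rewrite e /shear !H /=; ring.
- by exists (fun p r => shear (- s) (u^~ r) p), w => p q r t;
  rewrite e /shear !H /=; ring.
- by exists (fun p r t => shear (- s) (fun p => u p r t) p), w => p q r t;
  rewrite e /shear !H /=; ring.
Qed.

Lemma splits_shear3 s T : splits (shear3 s T) -> splits T.
Proof.
have e p q r t : T p q r t = shear (- s) (fun r => shear3 s T p q r t) r.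
  by rewrite /shear3 /shear !ord2E /=; ring.
move: (shear3 s T) e => T' e; case=> -[u [w H]];
  [apply: Or41 | apply: Or42 | apply: Or43 | apply: Or44].
- by exists u, (fun q r t => shear (- s) (fun r => w q r t) r) => p q r t;
  rewrite e /shear !H /=; ring.
- by exists (fun p => shear (- s) (u p)), w => p q r t;
  rewrite e /shear !H /=; ring.
- by exists u, (fun q => shear (- s) (w q)) => p q r t;
  rewrite e /shear !H /=; ring.
- by exists (fun p r t => shear (- s) (fun r => u p r t) r), w => p q r t;
  rewrite e /shear !H /=; ring.
Qed.

(** On each slice this is a row operation, which preserves the determinant. *)
Lemma singular_shear1 s T : singular_slices T -> singular_slices (shear1 s T).
Proof.
move=> H a0 a1 b0 b1; have {H} := H a0 a1 b0 b1.
set M := slice T a0 a1 b0 b1 => /= H.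
have e0 q : slice (shear1 s T) a0 a1 b0 b1 0 q = M 0 q.
  by rewrite /M /slice /shear1 /shear !ord2E /=; ring.
have e1 q : slice (shear1 s T) a0 a1 b0 b1 1 q = M 1 q - s * M 0 q.
  by rewrite /M /slice /shear1 /shear !ord2E /=; ring.
by rewrite !e0 !e1 !mulrBr H; ring.
Qed.

(** A shear of a measured index is absorbed into the vector contracted with it. *)
Lemma singular_shear3 s T : singular_slices T -> singular_slices (shear3 s T).
Proof.
move=> H a0 a1 b0 b1.
have e p q : slice (shear3 s T) a0 a1 b0 b1 p q = slice T (a0 - s * a1) a1 b0 b1 p q.
  by rewrite /slice /shear3 /shear !ord2E /=; ring.
by rewrite /= !e; apply: H.
Qed.

Lemma splits_shear2 s T : splits (shear2 s T) -> splits T.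
Proof.
by move=> h; apply/splits_swap12/(@splits_shear1 s)/splits_swap12.
Qed.

Lemma singular_shear2 s T : singular_slices T -> singular_slices (shear2 s T).
Proof. by move=> /singular_swap12/(singular_shear1 s)/singular_swap12. Qed.

Lemma splits_shear4 s T : splits (shear4 s T) -> splits T.
Proof.
by move=> h; apply/splits_swap34/(@splits_shear3 s)/splits_swap34.
Qed.

Lemma singular_shear4 s T : singular_slices T -> singular_slices (shear4 s T).
Proof. by move=> /singular_swap34/(singular_shear3 s)/singular_swap34. Qed.

(** * Tensors with unit pivot and vanishing neighbours *)

Lemma splits_row0 T : (forall q r t, T 1 q r t = 0) -> splits T.
Proof.
move=> T1; apply: Or41; exists (fun p => (p == 0)%:R), (T 0) => p q r t.
by case: (ord2_case p) => ->; rewrite ?T1 !ord2E /= ?mul1r ?mul0r.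
Qed.

Definition normalized T : Prop :=
  [/\ T 0 0 0 0 = 1, T 1 0 0 0 = 0, T 0 1 0 0 = 0, T 0 0 1 0 = 0 & T 0 0 0 1 = 0].

Lemma normalized_swap12 T : normalized T -> normalized (swap12 T).
Proof. by case. Qed.

(* The coefficients of the biquadratic form [det (slice T a0 a1 b0 b1)]. *)
Lemma normalized_coefs T : normalized T -> singular_slices T ->
  [/\ T 1 1 0 0 = 0, T 1 1 0 1 = 0, T 1 1 1 0 = 0 &
      T 1 1 1 1 = T 0 1 0 1 * T 1 0 1 0 + T 0 1 1 0 * T 1 0 0 1] /\
  [/\ T 0 1 0 1 * T 1 0 0 1 = 0, T 0 1 1 0 * T 1 0 1 0 = 0,
      T 0 0 1 1 * T 1 1 1 1 = T 0 1 1 1 * T 1 0 1 1,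
      T 0 1 1 0 * T 1 0 1 1 + T 0 1 1 1 * T 1 0 1 0 = 0 &
      T 0 1 0 1 * T 1 0 1 1 + T 0 1 1 1 * T 1 0 0 1 = 0].
Proof.
case=> t0 t1 t2 t3 t4 H.
(* A binary quadratic form is determined by its values at (1,0), (0,1) and (1,1); the nine points
   are the pairs of these. *)
have := (H 1 0 1 0, H 1 0 0 1, H 0 1 1 0, H 0 1 0 1,
         (H 1 0 1 1, H 0 1 1 1, H 1 1 1 0, H 1 1 0 1, H 1 1 1 1)).
rewrite /slice /= t0 t1 t2 t3 t4.
rewrite !(mulr0, mul0r, mulr1, mul1r, addr0, add0r).
move=> -[[[[h1 h2] h3] h4] [[[[h5 h6] h7] h8] h9]].
move: h5 h7 h9 h6 h8; rewrite h1 -h2 -h3 !add0r => h5 h7; rewrite h5 h7 !add0r.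
move=> h9 h6 h8.
(* Polarization: a mixed coefficient is the value at (1,1) minus those at (1,0) and (0,1), the other
   vector being fixed. *)
have e6 : T 0 1 1 0 * T 1 0 1 1 + T 0 1 1 1 * T 1 0 1 0 = 0.
  transitivity ((T 0 1 1 0 + T 0 1 1 1) * (T 1 0 1 0 + T 1 0 1 1) -
    T 0 1 1 0 * T 1 0 1 0 - T 0 1 1 1 * T 1 0 1 1); first by ring.
  by rewrite -h6 -h3 -h4; ring.
have e8 : T 0 1 0 1 * T 1 0 1 1 + T 0 1 1 1 * T 1 0 0 1 = 0.
  transitivity ((T 0 1 0 1 + T 0 1 1 1) * (T 1 0 0 1 + T 1 0 1 1) -
    T 0 1 0 1 * T 1 0 0 1 - T 0 1 1 1 * T 1 0 1 1); first by ring.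
  by rewrite -h8 -h2 -h4; ring.
(* What is left is the coefficient of [a0 a1 b0 b1], read off from the value at the all-ones point
   once the other eight are known. *)
do 2!split=> //; apply: (addIr (T 0 0 1 1 * T 1 1 1 1)); rewrite {2}h4.
transitivity ((1 + T 0 0 1 1) * T 1 1 1 1); first by ring.
rewrite h9; transitivity (T 0 1 0 1 * T 1 0 1 0 + T 0 1 1 0 * T 1 0 0 1 +
  T 0 1 1 1 * T 1 0 1 1 + T 0 1 0 1 * T 1 0 0 1 + T 0 1 1 0 * T 1 0 1 0 +
  (T 0 1 0 1 * T 1 0 1 1 + T 0 1 1 1 * T 1 0 0 1) +
  (T 0 1 1 0 * T 1 0 1 1 + T 0 1 1 1 * T 1 0 1 0)); first by ring.
by rewrite e6 e8 -h2 -h3 !addr0.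
Qed.

(** [T 1 0 1 1] is the only entry with first index 1 that may survive. If it vanishes, the first
    system factors out; otherwise it forces every entry with second index 1 to vanish, and the
    second system factors out. *)
Lemma splits_normalized_row T : normalized T -> singular_slices T ->
  T 1 0 0 1 = 0 -> T 1 0 1 0 = 0 -> splits T.
Proof.
move=> nT sT z1 z2; have [[h1 h5 h7 h9] [_ _ h4 h6 h8]] := normalized_coefs nT sT.
have [t0 t1 t2 t3 t4] := nT.
move: h4 h6 h8 h9; rewrite z1 z2 !(mulr0, addr0) => h4 h6 h8 h9.
have [z3|z3] := eqVneq (T 1 0 1 1) 0.
  apply: splits_row0 => q r t.
  by case: (ord2_case q) (ord2_case r) (ord2_case t) => -> [] -> [] ->.
have cancel x : x * T 1 0 1 1 = 0 -> x = 0.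
  by move/eqP; rewrite mulf_eq0 (negPf z3) orbF => /eqP.
have z4 := cancel _ h8; have z5 := cancel _ h6.
have z6 : T 0 1 1 1 = 0 by apply: cancel; rewrite -h4 h9 mulr0.
apply/splits_swap12/splits_row0 => p r t; rewrite /swap12.
by case: (ord2_case p) (ord2_case r) (ord2_case t) => -> [] -> [] ->.
Qed.

(** Since [T 0 1 0 1 * T 1 0 0 1 = 0] and exchanging the first two indices swaps these factors,
    [T 0 1 0 1 = 0] may be assumed. The case where [T 0 1 1 0] and [T 1 0 0 1] are both nonzero
    gives il | jk, and its mirror image ik | jl. *)
Lemma splits_normalized T : normalized T -> singular_slices T -> splits T.
Proof.
wlog z1 : T / T 0 1 0 1 = 0.
  move=> IH nT sT; have [_ [/eqP + _ _ _ _]] := normalized_coefs nT sT.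
  rewrite mulf_eq0 => /orP[] /eqP z; first exact: IH.
  exact/splits_swap12/(IH _ z (normalized_swap12 nT) (singular_swap12 sT)).
move=> nT sT; have [[h1 h5 h7 h9] [_ h3 h4 h6 h8]] := normalized_coefs nT sT.
have [t0 t1 t2 t3 t4] := nT.
have [z2|z2] := eqVneq (T 0 1 1 0) 0.
  apply: splits_swap12.
  exact: (splits_normalized_row (normalized_swap12 nT) (singular_swap12 sT)).
have cancel x : T 0 1 1 0 * x = 0 -> x = 0.
  by move/eqP; rewrite mulf_eq0 (negPf z2) => /eqP.
have z3 := cancel _ h3.
have [z4|z4] := eqVneq (T 1 0 0 1) 0; first exact: splits_normalized_row.
move: h4 h6 h8 h9; rewrite z1 z3 !(mul0r, mulr0, addr0, add0r).
move=> h4 /cancel z5 /eqP; rewrite mulf_eq0 (negPf z4) orbF => /eqP z6 h9.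
have z7 : T 0 0 1 1 = 0.
  move/eqP: h4; rewrite z6 mul0r h9 mulf_eq0 mulf_eq0 (negPf z2) (negPf z4) !orbF.
  by move/eqP.
(* Besides the pivot, only [T 0 1 1 0], [T 1 0 0 1] and their product [T 1 1 1 1] survive, so the
   first index is tied to the fourth and the second to the third. *)
apply: Or43; exists (fun p t => T p 0 0 t), (fun q r => T 0 q r 0) => p q r t.
by case: (ord2_case p) (ord2_case q) (ord2_case r) (ord2_case t) => -> [] -> [] -> [] ->;
  rewrite ?t0 ?t1 ?t2 ?t3 ?t4 ?z1 ?z3 ?z5 ?z6 ?z7 ?h1 ?h5 ?h7 ?h9; ring.
Qed.

Lemma splits_pivot T : T 0 0 0 0 != 0 -> singular_slices T -> splits T.
Proof.
wlog t0 : T / T 0 0 0 0 = 1.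
  move=> IH t0 H; pose c := (T 0 0 0 0)^-1.
  have [||||||] := IH (fun p q r t => c * T p q r t).
  - by rewrite mulVf.
  - by rewrite mulVf // oner_eq0.
  - move=> a0 a1 b0 b1 /=; have /= e := H a0 a1 b0 b1.
    have s p q : slice (fun p q r t => c * T p q r t) a0 a1 b0 b1 p q =
        c * slice T a0 a1 b0 b1 p q by rewrite /slice; ring.
    by rewrite !s mulrACA e mulrACA.
  - case=> u [w e]; apply: Or41; exists u, (fun q r t => c^-1 * w q r t) => p q r t.
    by rewrite mulrCA -e mulKf // invr_eq0.
  - case=> u [w e]; apply: Or42; exists u, (fun q r => c^-1 * w q r) => p q r t.
    by rewrite mulrCA -e mulKf // invr_eq0.
  - case=> u [w e]; apply: Or43; exists u, (fun q r => c^-1 * w q r) => p q r t.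
    by rewrite mulrCA -e mulKf // invr_eq0.
  - case=> u [w e]; apply: Or44; exists u, (fun q => c^-1 * w q) => p q r t.
    by rewrite mulrCA -e mulKf // invr_eq0.
move=> _ H.
(* Each shear changes only entries whose own index is 1, hence leaves the pivot and the other three
   neighbours alone; so all four constants are entries of the original tensor. *)
apply/(@splits_shear1 (T 1 0 0 0))/(@splits_shear2 (T 0 1 0 0)).
apply/(@splits_shear3 (T 0 0 1 0))/(@splits_shear4 (T 0 0 0 1)).
apply: splits_normalized; last first.
  by apply/singular_shear4/singular_shear3/singular_shear2/singular_shear1.
by split; rewrite /shear4 /shear3 /shear2 /shear1 /shear !ord2E t0 /=; ring.
Qed.

(** Translating the indices modulo 2 brings a nonzero entry to the pivot position; the same
    translation undoes itself. *)
Lemma splits_singular T : singular_slices T -> splits T.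
Proof.
move=> H.
have [/existsP[p0 /existsP[q0 /existsP[r0 /existsP[s0 nz]]]]|/negP all0] :=
    boolP [exists p, exists q, exists r, exists t, T p q r t != 0]; last first.
  apply: Or41; exists (fun=> 0), (fun _ _ _ => 0) => p q r t; rewrite mul0r.
  apply/eqP/negPn/negP => nz; apply: all0.
  apply/existsP; exists p; apply/existsP; exists q.
  by apply/existsP; exists r; apply/existsP; exists t.
have addK2 (x y : 'I_2) : x + y + y = x.
  by case: (ord2_case x) (ord2_case y) => -> [] ->; apply: val_inj.
have [|||||] := @splits_pivot (fun p q r t => T (p + p0) (q + q0) (r + r0) (t + s0)).
- by rewrite !add0r.
- have ns (x : 'I_2) : x = 0 \/ x = 1 := ord2_case x.
  have e00 : (0 + 0 : 'I_2) = 0 by apply: val_inj.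
  have e01 : (0 + 1 : 'I_2) = 1 by apply: val_inj.
  have e10 : (1 + 0 : 'I_2) = 1 by apply: val_inj.
  have e11 : (1 + 1 : 'I_2) = 0 by apply: val_inj.
  move=> a0 a1 b0 b1 /=.
  (* Flipping a measured index exchanges the coordinates of its vector; flipping the first or second
     index exchanges rows or columns, which only changes the sign of the determinant. *)
  pose A0 := if r0 == 0 then a0 else a1; pose A1 := if r0 == 0 then a1 else a0.
  pose B0 := if s0 == 0 then b0 else b1; pose B1 := if s0 == 0 then b1 else b0.
  have s p q : slice (fun p q r t => T (p + p0) (q + q0) (r + r0) (t + s0))
      a0 a1 b0 b1 p q = slice T A0 A1 B0 B1 (p + p0) (q + q0).
    rewrite /slice /A0 /A1 /B0 /B1.
    by case: (ns r0) (ns s0) => -> [] ->; rewrite !ord2E ?e00 ?e01 ?e10 ?e11; ring.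
  have := H A0 A1 B0 B1; rewrite !s /=.
  case: (ns p0) (ns q0) => -> [] ->; rewrite ?e00 ?e01 ?e10 ?e11 => e; ring: e.
- case=> u [w e]; apply: Or41; exists (fun p => u (p + p0)).
  by exists (fun q r t => w (q + q0) (r + r0) (t + s0)); move=> p q r t; rewrite -e !addK2.
- case=> u [w e]; apply: Or42; exists (fun p r => u (p + p0) (r + r0)).
  by exists (fun q t => w (q + q0) (t + s0)); move=> p q r t; rewrite -e !addK2.
- case=> u [w e]; apply: Or43; exists (fun p t => u (p + p0) (t + s0)).
  by exists (fun q r => w (q + q0) (r + r0)); move=> p q r t; rewrite -e !addK2.
- case=> u [w e]; apply: Or44; exists (fun p r t => u (p + p0) (r + r0) (t + s0)).
  by exists (fun q => w (q + q0)); move=> p q r t; rewrite -e !addK2.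
Qed.
End Tensors.

(** * Kets *)

Section Kets.
Variable R : realType.
Local Notation C := R[i].

Definition amp (T : finType) (v : ket R T) (x : T) : C := v (enum_rank x) 0.

Definition ket_of (T : finType) (f : T -> C) : ket R T := \col_x f (enum_val x).

Lemma amp_ket_of (T : finType) (f : T -> C) : amp (ket_of f) =1 f.
Proof. by move=> x; rewrite /amp mxE enum_rankK. Qed.

Lemma sum_enum_rank (V : nmodType) (T : finType) (f : 'I_#|T| -> V) :
  \sum_i f i = \sum_(x : T) f (enum_rank x).
Proof. by rewrite (reindex _ (onW_bij _ (enum_rank_bij T))). Qed.

Lemma entry_mxof (T1 T2 : finType) (f : T1 -> T2 -> C) x y :
  entry (mxof f) x y = f x y.
Proof. by rewrite /entry mxE !enum_rankK. Qed.

Lemma entry_mul (T1 T2 T3 : finType) (A : linop R T1 T2) (B : linop R T2 T3) x z :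
  entry (A *m B) x z = \sum_y entry A x y * entry B y z.
Proof. by rewrite /entry mxE sum_enum_rank. Qed.

Lemma entry_adj (T1 T2 : finType) (A : linop R T1 T2) x y :
  entry (A^t* ) x y = (entry A y x)^*.
Proof. by rewrite /entry !mxE. Qed.

Lemma entry_proj (T : finType) (v : ket R T) x y :
  entry (proj v) x y = amp v x * (amp v y)^*.
Proof. by rewrite /entry /proj mxE big_ord1 !mxE. Qed.

Lemma amp_mul (T1 T2 : finType) (A : linop R T1 T2) v x :
  amp (A *m v) x = \sum_y entry A x y * amp v y.
Proof. by rewrite /amp mxE sum_enum_rank. Qed.

Lemma inner_amp (T : finType) (v w : ket R T) :
  (v^t* *m w) 0 0 = \sum_x (amp v x)^* * amp w x.
Proof. by rewrite mxE sum_enum_rank; apply: eq_bigr => x _; rewrite !mxE. Qed.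

Lemma pure_stateE (T : finType) (v : ket R T) :
  pure_state v <-> \sum_x `|amp v x| ^+ 2 = 1.
Proof.
have e : (v^t* *m v) 0 0 = \sum_x `|amp v x| ^+ 2.
  by rewrite inner_amp; apply: eq_bigr => x _; rewrite normCKC.
split=> [pv|s1]; first by rewrite -e pv mxE eqxx.
by apply/matrixP => a b; rewrite !ord1 e s1 mxE eqxx.
Qed.

Lemma mxof_scalar (T : finType) (f : T -> T -> C) c :
  (forall x y, f x y = c *+ (x == y)) -> (mxof f : op R T) = c%:M.
Proof.
by move=> e; apply/matrixP => x y; rewrite !mxE e (inj_eq enum_val_inj).
Qed.

Lemma lift_proj (T1 T2 : finType) (A : linop R T1 T2) (v : ket R T2) :
  A *m proj v *m A^t* = proj (A *m v).
Proof. by rewrite /proj trmx_mul map_mxM !mulmxA. Qed.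

Lemma expectation_proj (T : finType) (e v : ket R T) (c : R) :
  expectation e (c%:C%C *: proj v) =
  c * complex.Re (`|\sum_x (amp e x)^* * amp v x| ^+ 2).
Proof.
rewrite /expectation -scalemxAr -scalemxAl mxE.
set z := (X in c%:C%C * X).
have -> : z = `|\sum_x (amp e x)^* * amp v x| ^+ 2.
  have -> : z = ((e^t* *m v) *m (v^t* *m e)) 0 0 by rewrite /z /proj !mulmxA.
  rewrite mxE big_ord1 normCK -inner_amp; congr (_ * _).
  rewrite !inner_amp rmorph_sum; apply: eq_bigr => x _.
  by rewrite rmorphM /= conjCK mulrC.
by move: (_ ^+ 2) => [a b]; rewrite /= mul0r subr0.
Qed.

Lemma inner_le (T : finType) (e v : ket R T) : pure_state e ->
  `|\sum_x (amp e x)^* * amp v x| ^+ 2 <= \sum_x `|amp v x| ^+ 2.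
Proof.
move=> pe.
have adjK n (u : 'cV[C]_n) : (u^t*)^t* = u.
  by apply/matrixP => i j; rewrite !mxE conjCK.
(* [dotmx] pairs row vectors, so it is applied to the adjoints. *)
have [+ _] := CauchySchwarz (@dotmx C #|T|) (e^t*) (v^t*).
have ee : (e^t* *m e) 0 0 = 1 by rewrite pe mxE.
rewrite /= !dotmxE !adjK ee mul1r !inner_amp => /le_trans; apply.
by apply: ler_sum => x _; rewrite normCKC.
Qed.

Lemma sep_of_product (P : finType) (S : {set P}) (v : ket R (all_labels P))
    (f g : all_labels P -> C) : pure_state v ->
  (forall x y : all_labels P, {in S, x =1 y} -> f x = f y) ->
  (forall x y : all_labels P, {in ~: S, x =1 y} -> g x = g y) ->
  (forall x, amp v x = f x * g x) -> SEP S (~: S) v.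
Proof.
move=> /pure_stateE pv fS gS vfg.
(* Labels are padded by 0 outside [A]; by [fS] and [gS] the padding does not affect [f] or [g]. *)
pose ext (A : {set P}) (a : labels A) : all_labels P :=
  [ffun k => oapp a 0 (insub k)].
have extE (A : {set P}) (x : all_labels P) : {in A, ext A (restrict A x) =1 x}.
  by move=> k kA; rewrite ffunE insubT /= ffunE.
pose glue (ab : labels S * labels (~: S)) : all_labels P :=
  [ffun k => if k \in S then ext S ab.1 k else ext (~: S) ab.2 k].
have glueE1 a b : restrict S (glue (a, b)) = a.
  apply/ffunP => -[k kS]; rewrite !ffunE /= kS insubT /=; congr (a _).
have glueE2 a b : restrict (~: S) (glue (a, b)) = b.
  apply/ffunP => -[k kS]; rewrite !ffunE /=; have := kS; rewrite inE => /negPf ->.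
  by rewrite insubT /=; congr (b _).
pose F a := f (ext S a); pose G b := g (ext (~: S) b).
have vFG x : amp v x = F (restrict S x) * G (restrict (~: S) x).
  by rewrite vfg /F /G (fS _ _ (@extE S x)) (gS _ _ (@extE (~: S) x)).
pose nF := \sum_a `|F a| ^+ 2; pose nG := \sum_b `|G b| ^+ 2.
have nFG : nF * nG = 1.
  rewrite -pv /nF /nG big_distrlr /= pair_big /=.
  rewrite (reindex (fun x : all_labels P => (restrict S x, restrict (~: S) x))) /=.
    by apply: eq_bigr => x _; rewrite vFG normrM exprMn.
  exists glue => [x _|[a b] _]; last by rewrite glueE1 glueE2.
  apply/ffunP => k; rewrite ffunE /=.
  by case: ifPn => kS; rewrite extE // inE.
have nF0 : 0 <= nF by apply: sumr_ge0 => a _; rewrite exprn_ge0.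
have nF_neq0 : nF != 0.
  by apply/eqP => z; move/eqP: nFG; rewrite z mul0r eq_sym oner_eq0.
have s2 : sqrtC nF ^+ 2 = nF by rewrite sqrtCK.
have sn0 : sqrtC nF != 0 by rewrite sqrtC_eq0.
have sr : `|sqrtC nF| = sqrtC nF by rewrite ger0_norm // sqrtC_ge0.
(* The squared norms of the factors multiply to 1, so moving [sqrtC nF] from one to the other
   normalizes both. *)
exists (ket_of (fun a => F a / sqrtC nF)), (ket_of (fun b => G b * sqrtC nF)); split.
- apply/pure_stateE; under eq_bigr do rewrite amp_ket_of normrM exprMn normfV sr exprVn s2.
  by rewrite -mulr_suml mulfV.
- apply/pure_stateE; under eq_bigr do rewrite amp_ket_of normrM exprMn sr s2.
  by rewrite -mulr_suml mulrC.
- move=> x; rewrite -!/(amp _ _) !amp_ket_of vFG.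
by rewrite mulrA [RHS]mulrAC divfK.
Qed.
End Kets.

(** * Fully entangled fraction of a pure state *)

Section FullyEntangled.
Variable R : realType.
Local Notation C := R[i].
Implicit Types (m e : ket R two_qubits).

Definition norm2 (T : finType) (v : ket R T) : R :=
  complex.Re (\sum_x `|amp v x| ^+ 2).

Lemma norm2E (T : finType) (v : ket R T) :
  (norm2 v)%:C%C = \sum_x `|amp v x| ^+ 2.
Proof.
apply: RRe_real; apply: ger0_real; apply: sumr_ge0 => x _.
by rewrite exprn_ge0.
Qed.

Lemma norm2_ge0 (T : finType) (v : ket R T) : 0 <= norm2 v.
Proof.
by rewrite -lecR norm2E; apply: sumr_ge0 => x _; rewrite exprn_ge0.
Qed.

Lemma norm2_eq0 (T : finType) (v : ket R T) : norm2 v = 0 -> amp v =1 fun=> 0.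
Proof.
move=> z x; have /eqP : \sum_x `|amp v x| ^+ 2 = 0 by rewrite -norm2E z.
rewrite psumr_eq0; last by move=> y _; rewrite exprn_ge0.
by move=> /allP/(_ x (mem_index_enum _)); rewrite sqrf_eq0 normr_eq0 => /eqP.
Qed.

Lemma sum_two_qubits (V : nmodType) (f : two_qubits -> V) :
  \sum_x f x = f (0, 0) + f (0, 1) + (f (1, 0) + f (1, 1)).
Proof.
transitivity (\sum_p \sum_q f (p, q)); last by rewrite !sum_ord2.
by rewrite pair_big; apply: eq_bigr => -[].
Qed.

Definition amp_det m : C :=
  amp m (0, 0) * amp m (1, 1) - amp m (0, 1) * amp m (1, 0).

(** Under the conditions of [entangled_ketP] the amplitude matrix is a unitary of determinant [w]
    divided by the square root of 2. *)
Definition entangled_ket (w x y : C) : ket R two_qubits :=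
  ket_of (fun c => if c.1 == 0 then (if c.2 == 0 then x else y)
                   else (if c.2 == 0 then - w * y^* else w * x^*)).

Lemma entangled_ketP w x y : w * w^* = 1 -> x * x^* + y * y^* = 2^-1 ->
  max_entangled (entangled_ket w x y).
Proof.
move=> ww xy; have h : (2^-1 : C) + 2^-1 = 1 by field.
split.
- apply/pure_stateE; rewrite sum_two_qubits !amp_ket_of /= !normCK.
  rewrite ?rmorphM ?rmorphN /= ?conjCK.
  transitivity (x * x^* + y * y^* + w * w^* * (x * x^* + y * y^*)); first by ring.
  by rewrite ww mul1r xy.
- apply: mxof_scalar => a b; rewrite !sum_ord2 !entry_proj !amp_ket_of /=.
  case: (ord2_case a) (ord2_case b) => -> [] ->; rewrite !ord2E /= ?mulr0n ?mulr1n.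
  + by [].
  + by rewrite ?rmorphM ?rmorphN /= ?conjCK; ring.
  + by ring.
  + rewrite ?rmorphM ?rmorphN /= ?conjCK.
    transitivity (w * w^* * (x * x^* + y * y^*)); first by ring.
    by rewrite ww mul1r xy.
- apply: mxof_scalar => a b; rewrite !sum_ord2 !entry_proj !amp_ket_of /=.
  case: (ord2_case a) (ord2_case b) => -> [] ->; rewrite !ord2E /= ?mulr0n ?mulr1n.
  + rewrite ?rmorphM ?rmorphN /= ?conjCK.
    transitivity (x * x^* + w * w^* * (y * y^*)); first by ring.
    by rewrite ww mul1r.
  + rewrite ?rmorphM ?rmorphN /= ?conjCK.
    transitivity (x * y^* * (1 - w * w^*)); first by ring.
    by rewrite ww subrr mulr0.
  + rewrite ?rmorphM ?rmorphN /= ?conjCK.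
    transitivity (y * x^* * (1 - w * w^*)); first by ring.
    by rewrite ww subrr mulr0.
  + rewrite ?rmorphM ?rmorphN /= ?conjCK.
    transitivity (w * w^* * (x * x^*) + y * y^*); first by ring.
    by rewrite ww mul1r.
Qed.

Lemma phase_exists (z : C) : exists2 w : C, w * w^* = 1 & z = w * `|z|.
Proof.
have [->|z0] := eqVneq z 0; first by exists 1; rewrite ?conjC1 ?normr0 ?mulr0 ?mulr1.
exists (z / `|z|); last by rewrite divfK // normr_eq0.
by rewrite -normCK normrM normfV normr_id divff ?normr_eq0 ?expr1n.
Qed.

(* The maximizer is the unitary factor in the polar decomposition of the
   amplitude matrix M, which for 2 x 2 matrices is proportional to M + w cof(M)^*,
   where w is the phase of det M and cof the cofactor matrix. *)
Lemma entangled_overlap m : norm2 m != 0 -> exists2 e, max_entangled e &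
  `|\sum_x (amp e x)^* * amp m x| ^+ 2 = (norm2 m)%:C%C / 2 + `|amp_det m|.
Proof.
move=> m0; have [w ww dw] := phase_exists (amp_det m).
set D := `|amp_det m| in dw *; pose S := (norm2 m)%:C%C + 2 * D.
have P_gt0 : 0 < (norm2 m)%:C%C :> C by rewrite ltcR lt_def m0 norm2_ge0.
have S_gt0 : 0 < S by rewrite ltr_wpDr // mulr_ge0 // normr_ge0.
(* This is the Frobenius norm of the matrix M + w cof(M)^* before normalization; the overlap then
   equals [S / s], whose square is [S / 2]. *)
pose s := sqrtC (2 * S).
have s2 : s ^+ 2 = 2 * S by rewrite sqrtCK.
have s_gt0 : 0 < s by rewrite sqrtC_gt0 mulr_gt0.
have sJ : s^* = s by apply/CrealP/ger0_real/ltW.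
have sn0 : s != 0 by rewrite gt_eqF.
pose a := amp m (0, 0); pose b := amp m (0, 1).
pose c := amp m (1, 0); pose d := amp m (1, 1).
have DJ : D^* = D by apply/CrealP/ger0_real; rewrite normr_ge0.
have eD : a * d - b * c = w * D by rewrite -dw.
have eD' : a^* * d^* - b^* * c^* = w^* * D.
  by rewrite -!rmorphM -rmorphB eD rmorphM /= DJ.
have eS : S = a * a^* + b * b^* + (c * c^* + d * d^*) + 2 * D.
  by rewrite /S norm2E sum_two_qubits !normCK.
have wD : w^* * (a * d - b * c) = D by rewrite eD mulrA [w^* * w]mulrC ww mul1r.
have wD' : w * (a^* * d^* - b^* * c^*) = D by rewrite eD' mulrA ww mul1r.
pose x := (a + w * d^*) / s; pose y := (b - w * c^*) / s.
have xJ : x^* = (a^* + w^* * d) / s.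
  by rewrite /x rmorphM rmorphD rmorphM fmorphV /= conjCK sJ.
have yJ : y^* = (b^* - w^* * c) / s.
  by rewrite /y rmorphM rmorphB rmorphM fmorphV /= conjCK sJ.
have S0 : S != 0 by rewrite gt_eqF.
have xE : x = (a + w * d^*) / s by []; have yE : y = (b - w * c^*) / s by [].
clearbody x y.
exists (entangled_ket w x y).
  apply: entangled_ketP => //; rewrite xJ yJ xE yE.
  transitivity (S / s ^+ 2); last by rewrite s2; field.
  rewrite mulf_div mulf_div -mulrDl -expr2 eS; congr (_ / _).
  transitivity (a * a^* + b * b^* + w * w^* * (c * c^* + d * d^*) +
    w^* * (a * d - b * c) + w * (a^* * d^* - b^* * c^*)); first by ring.
  by rewrite ww wD wD'; ring.
have -> : \sum_z (amp (entangled_ket w x y) z)^* * amp m z = S / s.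
  rewrite sum_two_qubits !amp_ket_of /= ?rmorphM ?rmorphN /= ?conjCK xJ yJ eS xE yE.
  rewrite -/a -/b -/c -/d.
  transitivity ((a * a^* + b * b^* + w * w^* * (c * c^* + d * d^*) +
    (w^* * (a * d - b * c)) *+ 2) / s); first by field.
  by rewrite ww wD; congr (_ / _); ring.
rewrite normrM normfV (gtr0_norm S_gt0) (gtr0_norm s_gt0) exprMn exprVn s2.
transitivity (S / 2); last by rewrite /S; field.
by field; exact: S0.
Qed.

(** Cauchy-Schwarz bounds the set of expectations, so that its [sup] dominates each member. *)
Lemma fef_proj_bound m (c : R) : 0 <= c ->
  forall e, max_entangled e -> expectation e (c%:C%C *: proj m) <= c * norm2 m.
Proof.
move=> c0 e [pe _ _]; rewrite expectation_proj ler_wpM2l //.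
have := inner_le m pe; rewrite -norm2E.
by case: (`|_| ^+ 2) => x y; rewrite lecE /= => /andP[].
Qed.

Lemma fef_proj_ge m (c : R) : 0 <= c -> norm2 m != 0 ->
  c * (norm2 m / 2 + complex.Re `|amp_det m|) <=
    fully_entangled_fraction (c%:C%C *: proj m).
Proof.
move=> c0 m0; have [e me ov] := entangled_overlap m0.
have -> : c * (norm2 m / 2 + complex.Re `|amp_det m|) =
    expectation e (c%:C%C *: proj m).
  rewrite expectation_proj ov; congr (c * _).
  have -> : (norm2 m)%:C%C / 2 = (norm2 m / 2)%:C%C :> C.
    by rewrite -[2 in LHS]/(2%:R) -(rmorph_nat (real_complex R)) -fmorphV -rmorphM.
  by case: `|_|.
apply: ub_le_sup; last by exists e.
by exists (c * norm2 m) => _ [e' me' <-]; apply: fef_proj_bound.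
Qed.

Lemma fef_proj_le m (c : R) : 0 <= c ->
  fully_entangled_fraction (c%:C%C *: proj m) <= c * norm2 m.
Proof.
move=> c0; apply: ge_sup; last by move=> _ [e me <-]; apply: fef_proj_bound.
(* [ge_sup] needs a nonempty set; the witness is the Bell vector (|00> + |11>) / sqrt 2. *)
exists (expectation (entangled_ket 1 (sqrtC 2^-1) 0) (c%:C%C *: proj m)).
exists (entangled_ket 1 (sqrtC 2^-1) 0) => //; apply: entangled_ketP.
  by rewrite conjC1 mulr1.
rewrite conjC0 mulr0 addr0 -normCK ger0_norm ?sqrtCK //.
by rewrite sqrtC_ge0 invr_ge0.
Qed.
End FullyEntangled.

(** * Measuring the other systems *)

Section Measurement.
Variables (R : realType) (P : finType) (i j : P).
Local Notation C := R[i].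
Local Notation K := (others i j).
Implicit Types (v : ket R (all_labels P)) (U : {k : P | k \in K} -> 'M[R[i]]_2).

Definition outcome_ket U (J : labels K) v : ket R two_qubits := outcome_op U J *m v.

(** Distributivity turns the sum over joint outcomes into a product of column inner products, one
    per measured system. *)
Lemma tensor_op_col_orthonormal U : local_unitaries U -> forall a b : labels K,
  \sum_J entry (tensor_op U) J a * (entry (tensor_op U) J b)^* = (a == b)%:R.
Proof.
move=> uU a b.
under eq_bigr do rewrite !entry_mxof rmorph_prod -big_split /=.
rewrite -(bigA_distr_bigA (fun k s => U k s (a k) * (U k s (b k))^*)) /=.
have e k : \sum_s U k s (a k) * (U k s (b k))^* = (a k == b k)%:R.
  have /unitarymxP/mulmx1C/matrixP/(_ (b k) (a k)) := uU k.
  rewrite !mxE eq_sym => <-; apply: eq_bigr => s _.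
  by rewrite !mxE mulrC.
rewrite (eq_bigr _ (fun k _ => e k)).
have [->|ab] := eqVneq a b; first by rewrite big1 // => k _; rewrite eqxx.
have /existsP[k kab] : [exists k, a k != b k].
  apply: contraNT ab => /existsPn h; apply/eqP/ffunP => k.
  by apply/eqP; move: (h k); rewrite negbK.
by rewrite (bigD1 k) //= (negPf kab) mul0r.
Qed.

(** * Outcome probabilities *)

Lemma restrict_othersC (x y : all_labels P) :
  (restrict (~: K) y == restrict (~: K) x) = ((x i == y i) && (x j == y j)).
Proof.
apply/eqP/andP => [e|[/eqP xi /eqP xj]].
  have h k (kK : k \in ~: K) : x k == y k.
    by apply/eqP; have /ffunP/(_ (exist _ k kK)) := e; rewrite !ffunE /=.
  by split; apply: h; rewrite !inE eqxx ?orbT.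
apply/ffunP => -[k kK]; rewrite !ffunE /=.
by move: kK; rewrite !inE negbK => /orP[] /eqP ->.
Qed.

(** The partial trace unfolds to pairs of global labels that agree on [i] and [j]. Grouping these
    pairs by their common value there gives [outcome_probE]; summing over [J] gives
    [sum_outcome_prob]. *)
Lemma outcome_prob_double U J v :
  outcome_prob U J (proj v) = complex.Re (\sum_(x : all_labels P)
   \sum_(y : all_labels P | (x i == y i) && (x j == y j))
    (entry (tensor_op U) J (restrict K x) * amp v x) *
    (entry (tensor_op U) J (restrict K y) * amp v y)^*).
Proof.
congr complex.Re; rewrite entry_mul.
under eq_bigr do rewrite entry_mul mulr_suml.
rewrite exchange_big /= [RHS](partition_big (restrict K) predT) //=.
apply: eq_bigr => a _.
transitivity (\sum_(x | restrict K x == a) \sum_b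
   \sum_(y | (restrict K y == b) && (restrict (~: K) y == restrict (~: K) x))
     (entry (tensor_op U) J a * amp v x) * (entry (tensor_op U) J b * amp v y)^*).
  rewrite exchange_big /=; apply: eq_bigr => b _.
  rewrite [entry (reduced_state _ _) _ _]entry_mxof mulr_sumr mulr_suml; apply: eq_bigr => x _.
  rewrite mulr_sumr mulr_suml; apply: eq_bigr => y _.
  by rewrite entry_proj entry_adj rmorphM /=; ring.
apply: eq_bigr => x /eqP <-.
rewrite [RHS](partition_big (restrict K) predT) //=; apply: eq_bigr => b _.
apply: eq_big => y; first by rewrite restrict_othersC andbC.
by case/andP => /eqP ->.
Qed.

Lemma outcome_ketE U J v (c : two_qubits) : amp (outcome_ket U J v) c =
  \sum_(x : all_labels P | (c.1 == x i) && (c.2 == x j))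
    entry (tensor_op U) J (restrict K x) * amp v x.
Proof.
rewrite amp_mul [RHS]big_mkcond; apply: eq_bigr => x _.
by rewrite entry_mxof; case: ifP => _; rewrite ?mul1r ?mul0r.
Qed.

Lemma outcome_probE U J v : outcome_prob U J (proj v) = norm2 (outcome_ket U J v).
Proof.
rewrite outcome_prob_double; congr complex.Re.
rewrite (partition_big (fun x : all_labels P => (x i, x j)) predT) //=.
apply: eq_bigr => -[p q] _; rewrite normCK outcome_ketE rmorph_sum mulr_suml /=.
apply: eq_big => x; first by rewrite xpair_eqE eq_sym [_ == q]eq_sym.
rewrite xpair_eqE => /andP[/eqP <- /eqP <-]; rewrite mulr_sumr.
by apply: eq_bigr.
Qed.

Lemma sum_outcome_prob U v : local_unitaries U -> pure_state v ->
  \sum_J outcome_prob U J (proj v) = 1.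
Proof.
move=> uU /pure_stateE pv.
under eq_bigr do rewrite outcome_prob_double.
rewrite -(raddf_sum (@complex.Re R : {additive R[i] -> R})).
rewrite -[RHS]/(complex.Re (1 : C)) -pv; congr complex.Re.
rewrite exchange_big; apply: eq_bigr => x _ /=.
rewrite exchange_big /=.
(* Summing over [J] first leaves a Kronecker delta on the measured systems; with agreement on [i]
   and [j], only [y = x] contributes. *)
transitivity (\sum_(y : all_labels P | (x i == y i) && (x j == y j))
  amp v x * (amp v y)^* * (restrict K x == restrict K y)%:R).
  apply: eq_bigr => y _; rewrite -(tensor_op_col_orthonormal uU) mulr_sumr.
  by apply: eq_bigr => J _; rewrite rmorphM /=; ring.
rewrite (bigD1 x) ?eqxx //= mulr1 -normCK big1 ?addr0 // => y /andP[xy ny].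
rewrite -restrict_othersC in xy.
have [e|] := eqVneq (restrict K x) (restrict K y); last by rewrite mulr0.
case/eqP: ny; apply/ffunP => k.
have [kK|kK] := boolP (k \in K).
  by have /ffunP/(_ (exist _ k kK)) := e; rewrite !ffunE.
have {}kK : k \in (~: K)%SET by rewrite finset.in_setC.
by have /eqP/ffunP/(_ (exist _ k kK)) := xy; rewrite !ffunE.
Qed.

Lemma post_measurementE U J v : post_measurement U J (proj v) =
  ((norm2 (outcome_ket U J v))^-1)%:C%C *: proj (outcome_ket U J v).
Proof. by rewrite /post_measurement outcome_probE lift_proj. Qed.

(** * Bounds on the average fully entangled fraction *)

Definition outcome_fidelity U v : R := \sum_J
  outcome_prob U J (proj v) * fully_entangled_fraction (post_measurement U J (proj v)).

Lemma outcome_term_le U J v :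
  outcome_prob U J (proj v) * fully_entangled_fraction (post_measurement U J (proj v))
  <= outcome_prob U J (proj v).
Proof.
rewrite post_measurementE outcome_probE; set m := outcome_ket U J v.
have [->|m0] := eqVneq (norm2 m) 0; first by rewrite mul0r.
rewrite -[leRHS]mulr1 ler_wpM2l ?norm2_ge0 //.
by rewrite (le_trans (fef_proj_le _ _)) ?invr_ge0 ?norm2_ge0 // mulVf.
Qed.

Lemma outcome_term_ge U J v :
  outcome_prob U J (proj v) / 2 + complex.Re `|amp_det (outcome_ket U J v)| <=
  outcome_prob U J (proj v) * fully_entangled_fraction (post_measurement U J (proj v)).
Proof.
rewrite post_measurementE outcome_probE; set m := outcome_ket U J v.
have [z|m0] := eqVneq (norm2 m) 0.
  (* An outcome of probability 0 has zero amplitudes, so its determinant vanishes too. *)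
  by rewrite z !mul0r /amp_det !(norm2_eq0 z) !mul0r subr0 normr0 addr0.
apply: le_trans (ler_wpM2l (norm2_ge0 m) (fef_proj_ge _ m0)); last first.
  by rewrite invr_ge0 norm2_ge0.
by rewrite mulVKf.
Qed.

Lemma le_f_frac U v : local_unitaries U -> pure_state v ->
  outcome_fidelity U v <= f_frac i j (proj v).
Proof.
move=> uU pv; apply: ub_le_sup; last by exists U.
exists 1 => _ [U' uU' <-]; rewrite -(sum_outcome_prob uU' pv).
by apply: ler_sum => J _; apply: outcome_term_le.
Qed.

(** The halved probabilities already sum to 1/2, which leaves no room for the nonnegative terms
    |det|. *)
Lemma half_f_frac_det0 U v : local_unitaries U -> pure_state v ->
  f_frac i j (proj v) = 2^-1 -> forall J, amp_det (outcome_ket U J v) = 0.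
Proof.
move=> uU pv f12 J; apply/eqP; rewrite -normr_eq0.
have n0 J' : 0 <= complex.Re `|amp_det (outcome_ket U J' v)|.
  by have := normr_ge0 (amp_det (outcome_ket U J' v)); rewrite lecE => /andP[].
have s0 : \sum_J' complex.Re `|amp_det (outcome_ket U J' v)| <= 0.
  rewrite -(lerD2l 2^-1) addr0 -{2}f12; apply: le_trans (le_f_frac uU pv).
  have -> : 2^-1 = \sum_J' outcome_prob U J' (proj v) / 2 :> R.
    by rewrite -mulr_suml sum_outcome_prob // mul1r.
  by rewrite -big_split; apply: ler_sum => J' _; apply: outcome_term_ge.
have /eqP : \sum_J' complex.Re `|amp_det (outcome_ket U J' v)| = 0.
  by apply: le_anti; rewrite s0 sumr_ge0.
rewrite psumr_eq0 // => /allP/(_ J (mem_index_enum _))/eqP e.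
have := RRe_real (normr_real (amp_det (outcome_ket U J v))).
by rewrite e => <-.
Qed.
End Measurement.

(** * Four qubits *)

Section FourQubits.
Variable R : realType.
Local Notation C := R[i].

(** Completes a prescribed unit row to a unitary; outcome 0 then contracts with that row. *)
Definition qubit_unitary (a0 a1 : C) : 'M[C]_2 :=
  \matrix_(r, s) if r == 0 then (if s == 0 then a0 else a1)
                 else (if s == 0 then - a1^* else a0^*).

Lemma qubit_unitaryP a0 a1 : `|a0| ^+ 2 + `|a1| ^+ 2 = 1 ->
  qubit_unitary a0 a1 \is unitarymx.
Proof.
rewrite !normCK => n1; apply/unitarymxP/matrixP => r s.
rewrite !mxE sum_ord2 !mxE.
case: (ord2_case r) (ord2_case s) => -> [] ->; rewrite !ord2E /= ?rmorphN /= ?conjCK;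
  rewrite -?n1; ring.
Qed.

Lemma qubit_normalize (a0 a1 : C) : exists c x0 x1 : C,
  [/\ a0 = c * x0, a1 = c * x1 & `|x0| ^+ 2 + `|x1| ^+ 2 = 1].
Proof.
pose n := sqrtC (`|a0| ^+ 2 + `|a1| ^+ 2).
have n2 : n ^+ 2 = `|a0| ^+ 2 + `|a1| ^+ 2 by rewrite sqrtCK.
have [z|nz] := eqVneq n 0.
  have /eqP : `|a0| ^+ 2 + `|a1| ^+ 2 = 0 by rewrite -n2 z expr0n.
  rewrite paddr_eq0 ?exprn_ge0 // !sqrf_eq0 !normr_eq0 => /andP[/eqP -> /eqP ->].
  (* The zero vector is 0 times an arbitrary unit vector. *)
  by exists 0, 1, 0; rewrite !mul0r normr0 normr1 expr0n expr1n addr0.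
exists n, (a0 / n), (a1 / n); split; try by rewrite mulrC divfK.
have nn : `|n| = n by rewrite ger0_norm // sqrtC_ge0 addr_ge0 ?exprn_ge0.
by rewrite !normrM normfV nn !exprMn -mulrDl -n2 exprVn divff ?expf_neq0.
Qed.

(** * Amplitudes indexed by the four systems *)

Variables (i j k l : 'I_4).
Hypothesis ijkl : uniq [:: i; j; k; l].

Definition label4 (p q r s : 'I_2) : all_labels 'I_4 :=
  [ffun z => if z == i then p else if z == j then q else if z == k then r else s].

Lemma ijkl_neq : (((i == j) = false) * ((i == k) = false) * ((i == l) = false) *
   ((j == k) = false) * ((j == l) = false) * ((k == l) = false)) *
  (((j == i) = false) * ((k == i) = false) * ((l == i) = false) *
   ((k == j) = false) * ((l == j) = false) * ((l == k) = false)).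
Proof.
rewrite (eq_sym j i) (eq_sym k i) (eq_sym l i) (eq_sym k j) (eq_sym l j) (eq_sym l k).
move: ijkl; rewrite /= !inE !negb_or andbT => /and3P[/and3P[ij ik il] /andP[jk jl] kl].
by rewrite !(negPf ij, negPf ik, negPf il, negPf jk, negPf jl, negPf kl).
Qed.

(** Otherwise ['I_4] would contain five distinct elements. *)
Lemma label4_cover z : [|| z == i, z == j, z == k | z == l].
Proof.
have := @uniq_leq_size _ [:: z; i; j; k; l] (enum 'I_4).
rewrite size_enum_ord => h; apply: contraT => nz.
have : (5 <= 4)%N; last by [].
apply: h; last by move=> y _; rewrite mem_enum.
by rewrite cons_uniq ijkl andbT !inE.
Qed.

Lemma label4E p q r s (x := label4 p q r s) :
  [/\ x i = p, x j = q, x k = r & x l = s].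
Proof.
by rewrite /x !ffunE !eqxx !ijkl_neq.
Qed.

Lemma label4_eta (x : all_labels 'I_4) : label4 (x i) (x j) (x k) (x l) = x.
Proof.
have [ei ej ek el] := label4E (x i) (x j) (x k) (x l).
by apply/ffunP => z; case/or4P: (label4_cover z) => /eqP ->.
Qed.

Lemma mem_others z : (z \in others i j) = (z == k) || (z == l).
Proof.
by rewrite !inE; case/or4P: (label4_cover z) => /eqP ->; rewrite !eqxx ?ijkl_neq.
Qed.

Lemma outcome_ket4 (u : 'I_4 -> 'M[C]_2) (phi : ket R (all_labels 'I_4)) p q :
  amp (outcome_ket (fun z : {z | z \in others i j} => u (val z)) [ffun=> 0] phi) (p, q) =
  \sum_r \sum_s u k 0 r * u l 0 s * amp phi (label4 p q r s).
Proof.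
have kl : k != l by rewrite ijkl_neq.
rewrite outcome_ketE pair_big /=.
(* Global labels with prescribed values at [i] and [j] are parametrized by their values at [k] and
   [l]. *)
rewrite (reindex (fun rs : 'I_2 * 'I_2 => label4 p q rs.1 rs.2)) /=.
  have e rs : (p == label4 p q rs.1 rs.2 i) && (q == label4 p q rs.1 rs.2 j).
    by have [-> -> _ _] := label4E p q rs.1 rs.2; rewrite !eqxx.
  apply: eq_big => [rs|[r s] _]; first by rewrite e.
  congr (_ * _); have [_ _ rk sl] := label4E p q r s.
  rewrite entry_mxof.
  transitivity (\prod_(z in others i j) u z 0 (label4 p q r s z)).
    by rewrite [RHS]big_sub; apply: eq_bigr => z _; rewrite !ffunE.
  rewrite (eq_bigl _ _ mem_others) (bigD1 k) ?eqxx //= (bigD1 l) ?eqxx ?orbT 1?eq_sym //=.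
  rewrite big1 ?mulr1 /= ?rk ?sl // => z /andP[/andP[/orP[/eqP ->|/eqP ->]]];
  by rewrite eqxx.
exists (fun x => (x k, x l)) => [[r s] _ | x].
  by have [_ _ -> ->] := label4E p q r s.
by rewrite inE => /andP[/eqP -> /eqP ->] /=; rewrite label4_eta.
Qed.

(** Unit vectors are first rows of unitaries, so outcome 0 on both measured systems gives a singular
    matrix; arbitrary vectors follow because the determinant is homogeneous. *)
Lemma singular_slices_amp (phi : ket R (all_labels 'I_4)) : pure_state phi ->
  f_frac i j (proj phi) = 2^-1 ->
  singular_slices (fun p q r s => amp phi (label4 p q r s)).
Proof.
move=> pphi f12 a0 a1 b0 b1.
have [c [x0 [x1 [-> -> nx]]]] := qubit_normalize a0 a1.
have [d [y0 [y1 [-> -> ny]]]] := qubit_normalize b0 b1.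
have kl : k != l by rewrite ijkl_neq.
pose u z := if z == k then qubit_unitary x0 x1 else qubit_unitary y0 y1.
have uU : local_unitaries (fun z : {z | z \in others i j} => u (val z)).
  by move=> z; rewrite /u; case: ifP => _; apply: qubit_unitaryP.
have := half_f_frac_det0 uU pphi f12 [ffun=> 0].
rewrite /amp_det !outcome_ket4 !sum_ord2 /u eqxx !ijkl_neq !mxE /=.
move=> /subr0_eq e.
set T := fun p q r s => amp phi (label4 p q r s).
have h p q : slice T (c * x0) (c * x1) (d * y0) (d * y1) p q =
    c * d * (x0 * y0 * T p q 0 0 + x0 * y1 * T p q 0 1 +
    (x1 * y0 * T p q 1 0 + x1 * y1 * T p q 1 1)) by rewrite /slice; ring.
by rewrite /= !h mulrACA e mulrACA.
Qed.

Lemma sep_of_splits (phi : ket R (all_labels 'I_4)) : pure_state phi ->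
  splits (fun p q r s => amp phi (label4 p q r s)) ->
  exists G : {set 'I_4}, [/\ i \in G, j \in ~: G & SEP G (~: G) phi].
Proof.
move=> pphi; case=> -[u [w h]].
- exists [set i]; split; rewrite ?inE ?eqxx ?ijkl_neq ?orbT //.
  apply: (@sep_of_product _ _ _ _ (fun x => u (x i))
    (fun x => w (x j) (x k) (x l))) => //.
  + by move=> x y e; rewrite e // !inE ?eqxx ?orbT.
  + by move=> x y e; rewrite !e // !inE ?eqxx ?orbT ?ijkl_neq.
  + by move=> x; rewrite -h label4_eta.
- exists [set i; k]; split; rewrite ?inE ?eqxx ?ijkl_neq ?orbT //.
  apply: (@sep_of_product _ _ _ _ (fun x => u (x i) (x k))
    (fun x => w (x j) (x l))) => //.
  + by move=> x y e; rewrite !e // !inE ?eqxx ?orbT.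
  + by move=> x y e; rewrite !e // !inE ?eqxx ?orbT ?ijkl_neq.
  + by move=> x; rewrite -h label4_eta.
- exists [set i; l]; split; rewrite ?inE ?eqxx ?ijkl_neq ?orbT //.
  apply: (@sep_of_product _ _ _ _ (fun x => u (x i) (x l))
    (fun x => w (x j) (x k))) => //.
  + by move=> x y e; rewrite !e // !inE ?eqxx ?orbT.
  + by move=> x y e; rewrite !e // !inE ?eqxx ?orbT ?ijkl_neq.
  + by move=> x; rewrite -h label4_eta.
- exists [set i; k; l]; split; rewrite ?inE ?eqxx ?ijkl_neq ?orbT //.
  apply: (@sep_of_product _ _ _ _ (fun x => u (x i) (x k) (x l))
    (fun x => w (x j))) => //.
  + by move=> x y e; rewrite !e // !inE ?eqxx ?orbT.
  + by move=> x y e; rewrite !e // !inE ?eqxx ?orbT ?ijkl_neq.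
  + by move=> x; rewrite -h label4_eta.
Qed.
End FourQubits.

Lemma complete_pair (i j : 'I_4) : i != j -> exists k l, uniq [:: i; j; k; l].
Proof.
move=> ij; have [s us sz] : exists2 s, uniq [:: i, j & s] & size s = 2%N.
  exists (enum (~: [set i; j])%SET).
    rewrite /= !inE enum_uniq !mem_enum !inE !eqxx ?orbT ?negb_or ij.
    by rewrite ?eqxx ?orbT.
  by rewrite -cardE; apply/eqP; rewrite -(eqn_add2l #|[set i; j]|) cardsC card_ord cards2 ij.
by by case: s us sz => [|k [|l []]] // us _; exists k, l.
Qed.

(* The systems A, B, C, D are the four elements of 'I_4. *)
Theorem proposition9 (R : realType) (phi : ket R (all_labels 'I_4))
  (phi_pure : pure_state phi) (i j : 'I_4) (ij : i != j) :
  F_fid i j (proj phi) = 2 / 3 ->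
  exists G : {set 'I_4}, [/\ i \in G, j \in ~: G & SEP G (~: G) phi].
Proof.
rewrite /F_fid => F23; have [k [l ijkl]] := complete_pair ij.
apply: (sep_of_splits ijkl) => //; apply: splits_singular.
by apply: (singular_slices_amp ijkl) => //; lra.
Qed.
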